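(* Let $G=(V,E)$ be a graph which is an $n$-convex geometry. Then $G$ is true twins free, i.e., there are no two distinct vertices $x,y\in V$ with $N[x]=N[y]$.
   Context: All graphs are finite, simple and undirected, with non-empty vertex set. For a graph $G=(V,E)$ and $x\in V$, the closed neighbourhood of $x$ is $N[x]=\{x\}\cup\{y\in V:\{x,y\}\in E\}$. For $Y\subseteq V$, the common closed neighbourhood is $N[Y]=\bigcap_{y\in Y}N[y]$ if $Y\neq\varnothing$, and $N[\varnothing]=V$. The neighbourhood convexity of $G$ is the family $n_G=\{N[Y]:Y\subseteq V\}\cup\{\varnothing\}$ of subsets of $V$; it contains $\varnothing$ and $V$ and is closed under intersection. Its members are called $n$-convex sets. For $X\subseteq V$ the convex hull $[X]_{n}$ is the intersection of all $n$-convex sets containing $X$. For an $n$-convex set $K$, $\operatorname{ex}(K)=\{x\in K: K\setminus\{x\}\in n_G\}$ is the set of extreme points of $K$. $G$ is an $n$-convex geometry if $K=[\operatorname{ex}(K)]_{n}$ for every $n$-convex set $K$. *)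

(* Defs.v *)
From mathcomp Require Import all_boot.

Set Implicit Arguments.
Unset Strict Implicit.
Unset Printing Implicit Defensive.

(* A finite simple undirected graph is a symmetric irreflexive relation
   e on a finType T of vertices; these hypotheses, together with the
   non-emptiness of T, are assumed in theorems rather than in definitions. *)

Definition closed_nbhd (T : finType) (e : rel T) (x : T) : {set T} :=
  x |: [set y | e x y].

(* For Y = set0 the intersection is the full vertex set [set: T]. *)
Definition common_nbhd (T : finType) (e : rel T) (Y : {set T}) : {set T} :=
  \bigcap_(y in Y) closed_nbhd e y.

Definition n_convexity (T : finType) (e : rel T) : {set {set T}} :=
  [set common_nbhd e Y | Y : {set T}] :|: [set set0].

Definition n_hull (T : finType) (e : rel T) (X : {set T}) : {set T} :=
  \bigcap_(K in n_convexity e | X \subset K) K.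

Definition n_extreme (T : finType) (e : rel T) (K : {set T}) : {set T} :=
  [set x in K | K :\ x \in n_convexity e].

Definition n_convex_geometry (T : finType) (e : rel T) : Prop :=
  forall K : {set T}, K \in n_convexity e -> K = n_hull e (n_extreme e K).

Definition true_twins_free (T : finType) (e : rel T) : Prop :=
  ~ exists x y : T, x <> y /\ closed_nbhd e x = closed_nbhd e y.

(* Main.v *)
(* The least n-convex set containing x is N[N[x]], so its only possible extreme
   point is x.  For true twins x <> y the sets N[N[x]] and N[N[y]] coincide and
   hence have no extreme point at all; being the hull of the empty set, which
   is n-convex, such a set would be empty, although it contains x. *)
Require Import Defs.
From mathcomp Require Import all_boot.

Set Implicit Arguments.
Unset Strict Implicit.
Unset Printing Implicit Defensive.

Lemma closed_nbhd_sym (T : finType) (e : rel T) (x y : T) :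
  symmetric e -> (x \in closed_nbhd e y) = (y \in closed_nbhd e x).
Proof. by move=> e_sym; rewrite !inE eq_sym e_sym. Qed.

(** Closed adjacency is symmetric under [e_sym]. Turning membership into inclusion reduces the
    minimality argument below to transitivity of inclusion. *)
Lemma mem_common_nbhd (T : finType) (e : rel T) (x : T) (Y : {set T}) :
  symmetric e -> (x \in common_nbhd e Y) = (Y \subset closed_nbhd e x).
Proof.
move=> e_sym; apply/bigcapP/subsetP => H y /H; by rewrite closed_nbhd_sym.
Qed.

Lemma mem_common_nbhd_closed_nbhd (T : finType) (e : rel T) (x : T) :
  symmetric e -> x \in common_nbhd e (closed_nbhd e x).
Proof. by move=> e_sym; rewrite mem_common_nbhd. Qed.

(** If K = N[Y] contains x, then Y lies in N[x], and N[.] reverses inclusions. The case of empty K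
    is excluded by x. *)
Lemma common_nbhd_closed_nbhd_min (T : finType) (e : rel T) (x : T)
    (K : {set T}) :
  symmetric e -> K \in n_convexity e -> x \in K ->
  common_nbhd e (closed_nbhd e x) \subset K.
Proof.
move=> e_sym; rewrite !inE => /orP[/imsetP[Y _ ->]|/eqP ->]; last by rewrite inE.
rewrite mem_common_nbhd // => sYx; apply/subsetP => z.
by rewrite !mem_common_nbhd //; apply: subset_trans.
Qed.

(** Deleting some z other than x would leave an n-convex set that still contains x, hence by
    minimality all of N[N[x]], including z. *)
Lemma n_extreme_common_nbhd_closed_nbhd (T : finType) (e : rel T) (x z : T) :
  symmetric e -> z \in n_extreme e (common_nbhd e (closed_nbhd e x)) -> z = x.
Proof.
move=> e_sym; rewrite inE => /andP[zK Kz]; apply: contraTeq isT => z_neq_x.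
have xKz : x \in common_nbhd e (closed_nbhd e x) :\ z.
  by rewrite in_setD1 eq_sym z_neq_x mem_common_nbhd_closed_nbhd.
have /subsetP/(_ z zK) := common_nbhd_closed_nbhd_min e_sym Kz xKz.
by rewrite in_setD1 eqxx.
Qed.

Lemma n_hull0 (T : finType) (e : rel T) : n_hull e set0 = set0.
Proof.
apply/eqP; rewrite -subset0; apply: bigcap_inf.
by rewrite sub0set !inE eqxx orbT.
Qed.

Theorem theorem14 (T : finType) (e : rel T)
    (T_nonempty : 0 < #|T|)
    (e_sym : symmetric e) (e_irr : irreflexive e)
    (e_geom : n_convex_geometry e) :
  true_twins_free e.
Proof.
move=> [x [y [x_neq_y Nxy]]].
set K := common_nbhd e (closed_nbhd e x).
have K_conv : K \in n_convexity e by rewrite inE imset_f.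
have exK0 : n_extreme e K = set0.
  apply/setP => z; rewrite [RHS]inE; apply/negP => zK; apply: x_neq_y.
  (* An extreme point z of K equals x; reading K as N[N[y]] through [Nxy], it also equals y. *)
  rewrite -(n_extreme_common_nbhd_closed_nbhd e_sym zK).
  by rewrite /K Nxy in zK; apply: n_extreme_common_nbhd_closed_nbhd zK.
have := mem_common_nbhd_closed_nbhd x e_sym.
by rewrite -/K (e_geom K K_conv) exK0 n_hull0 inE.
Qed.
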